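(* For all integers $n\ge 1$ and $m\ge 0$, the number of $(n,m)$-$(R,\vec r)$-graphs is $$G_{R,\vec r}(n,m)=\frac{1}{2^m m!}\sum_{\{\vec n\in\mathbb N^q\,:\,n_1+\cdots+n_q=n\}}\binom{n}{\vec n}\,\vec r^{\;\vec n}\left(\vec n^{T}R\,\vec n\right)^m .$$
   Context: Fix $q\ge 1$, a symmetric irreducible $q\times q$ matrix $R=(R_{i,j})$ and a vector $\vec r=(r_1,\dots,r_q)^T$, both with non-negative real entries. Vectors are column vectors; $\vec u^{\,\vec v}=\prod_i u_i^{v_i}$; $\binom{n}{\vec n}=n!/\prod_i n_i!$ when $\sum_i n_i=n$. Graphs are labelled, with vertex set $\{1,\dots,n\}$; loops and multiple edges are allowed. For a graph $G$ with $n$ vertices and $m$ edges, $\mathrm{seqv}(G)$ is the number of sequences $(v_1,w_1,\dots,v_m,w_m)\in\{1,\dots,n\}^{2m}$ such that the multiset of unordered pairs $\overline{v_iw_i}$, $1\le i\le m$, is the edge multiset of $G$. The compensation factor is $\kappa(G)=\mathrm{seqv}(G)/(2^m m!)$. An $(R,\vec r)$-graph is a labelled graph in which each vertex $v$ is given a type $t(v)\in\{1,\dots,q\}$; its weight is $\omega(G)=\kappa(G)\prod_{u}r_{t(u)}\prod_{\overline{vw}}R_{t(v),t(w)}$, with products over the vertices $u$ and the edges $\overline{vw}$ of $G$ (with multiplicity). The ''number'' of $(R,\vec r)$-graphs in a family means the sum of their weights. An $(n,m)$-$(R,\vec r)$-graph is an $(R,\vec r)$-graph with $n$ vertices and $m$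 edges. *)

(* Defs.v *)
From HB Require Import structures.
From mathcomp Require Import all_boot all_order all_fingroup all_algebra.
From mathcomp Require Import reals.

Set Implicit Arguments.
Unset Strict Implicit.
Unset Printing Implicit Defensive.

Import Order.TTheory GRing.Theory Num.Theory.
Local Open Scope ring_scope.

(* An unordered pair of vertices, loops included, is encoded by its unique
   ordered representative (v, w) with v <= w. *)
Definition upair (n : nat) := {p : 'I_n * 'I_n | (p.1 <= p.2)%N}.

(* A labelled multigraph is its edge multiset, given by multiplicities.  The
   bound m.+1 on the multiplicities is no restriction when there are m edges; it
   makes the type finite. *)
Record mgraph (n m : nat) := MGraph {
  mult : {ffun upair n -> 'I_m.+1};
  _ : (\sum_(e : upair n) mult e)%N == m }.

HB.instance Definition _ (n m : nat) := [isSub for @mult n m].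
HB.instance Definition _ (n m : nat) := [Finite of mgraph n m by <:].

(* The sequence (v_1, w_1, ..., v_m, w_m) is encoded as the tuple of the pairs
   (v_i, w_i). *)
Definition seqv (n m : nat) (G : mgraph n m) : nat :=
  #|[set s : m.-tuple ('I_n * 'I_n) | [forall e : upair n,
      count (fun p : 'I_n * 'I_n =>
               [set p.1; p.2] == [set (val e).1; (val e).2]) s
      == mult G e :> nat]]|.

Definition kappa (K : realType) (n m : nat) (G : mgraph n m) : K :=
  (seqv G)%:R / (2 ^+ m * m`!%:R).

(* An (n, m)-(R, r)-graph: a multigraph together with the types of its vertices. *)
Definition tgraph (q n m : nat) := (mgraph n m * {ffun 'I_n -> 'I_q})%type.

(* The last product is independent of the encoding of the edges when R is
   symmetric. *)
Definition weight (K : realType) (q : nat) (R : 'M[K]_q) (r : 'cV[K]_q)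
    (n m : nat) (G : tgraph q n m) : K :=
  kappa K G.1 * (\prod_(u < n) r (G.2 u) 0)
  * \prod_(e : upair n) R (G.2 (val e).1) (G.2 (val e).2) ^+ mult G.1 e.

Definition weighted_number (K : realType) (q : nat) (R : 'M[K]_q) (r : 'cV[K]_q)
    (n m : nat) (F : {set tgraph q n m}) : K :=
  \sum_(G in F) weight R r G.

(* A matrix is reducible when a simultaneous permutation of its rows and columns
   makes it block upper triangular, with two square diagonal blocks of positive
   sizes k and q - k.  In particular every 1 x 1 matrix is irreducible. *)
Definition irreducible_mx (K : realType) (q : nat) (R : 'M[K]_q) : Prop :=
  ~ exists (s : 'S_q) (k : nat), (0 < k < q)%N /\
      forall i j : 'I_q, (j < k <= i)%N ->
        (perm_mx s *m R *m (perm_mx s)^T) i j = 0.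

Definition multinomial (K : realType) (q n : nat) (v : {ffun 'I_q -> 'I_n.+1}) : K :=
  n`!%:R / \prod_(i < q) (v i)`!%:R.

Definition vpow (K : realType) (q n : nat) (u : 'cV[K]_q)
    (v : {ffun 'I_q -> 'I_n.+1}) : K :=
  \prod_(i < q) u i 0 ^+ v i.

Definition natcol (K : realType) (q n : nat) (v : {ffun 'I_q -> 'I_n.+1}) : 'cV[K]_q :=
  \col_(i < q) (v i)%:R.

(* Main.v *)
Require Import Defs.
From HB Require Import structures.
From mathcomp Require Import all_boot all_order all_fingroup all_algebra.
From mathcomp Require Import reals.

Set Implicit Arguments.
Unset Strict Implicit.
Unset Printing Implicit Defensive.

Import Order.TTheory GRing.Theory Num.Theory.
Local Open Scope ring_scope.

(** Fix the types of the vertices.  The factor seqv(G) turns the sum over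
    multigraphs into a sum over sequences of m ordered pairs of vertices, because
    every such sequence has exactly one multigraph as its edge multiset
    ([edge_matchE], [seqv_graph_of_seq]).  As R is symmetric, the edge weight of
    that multigraph is the product of R over the pairs of the sequence
    ([prod_graph_of_seq]), so by distributivity the m pairs are chosen
    independently and contribute an m-th power ([sum_seqv_prod]).  Its base, the
    sum of R over all ordered pairs of vertices, depends on the types only
    through the number n_i of vertices of each type i, and equals the quadratic
    form of R at the vector of the n_i; the vertex weights likewise multiply to
    r^n ([sum_comp], [prod_comp]).  It remains to group the type assignments by
    that vector: the number of assignments with given n_i is the multinomial
    coefficient ([card_ffun_fibres]). *)

(** * Words and maps with prescribed fibre sizes *)

Lemma sum_tuple_cons (K : nmodType) (T : finType) (n : nat)
    (P : pred (n.+1.-tuple T)) (F : n.+1.-tuple T -> K) :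
  \sum_(t : n.+1.-tuple T | P t) F t
  = \sum_(x : T) \sum_(t : n.-tuple T | P [tuple of x :: t]) F [tuple of x :: t].
Proof.
rewrite pair_big_dep /=.
rewrite (reindex (fun p : T * n.-tuple T => [tuple of p.1 :: p.2])) //=.
exists (fun t => (thead t, [tuple of behead t])) => [[x t] _ | t _] /=.
  by congr (_, _); apply: val_inj.
by rewrite [RHS]tuple_eta.
Qed.

(** The recursion removes the first letter: with first letter i (impossible when
    v_i = 0, as the factor v_i reflects) the count for
    v - e_i applies, and v! = v_i (v - e_i)!, where v! is the product of the v_j!;
    the sum over i of v_i n! is
    (n + 1) n!. *)
Lemma card_tuple_count (T : finType) (n : nat) (v : T -> nat) :
  (\sum_i v i)%N = n ->
  (#|[set t : n.-tuple T | [forall i, count_mem i t == v i]]|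
     * \prod_i (v i)`! = n`!)%N.
Proof.
elim: n v => [|n IHn] v sum_v.
  have v0 i : v i = 0%N.
    by apply/eqP; move/eqP: sum_v; rewrite sum_nat_eq0 => /forallP/(_ i).
  rewrite big1 => [|i _]; last by rewrite v0.
  rewrite muln1 (_ : [set _ | _] = setT) ?cardsT ?card_tuple //.
  by apply/setP=> t; rewrite !inE tuple0; apply/forallP=> i; rewrite v0.
rewrite -sum1_card (eq_bigl (fun t : n.+1.-tuple T =>
  [forall i, count_mem i t == v i])) => [|t]; last by rewrite inE.
rewrite (@sum_tuple_cons nat) big_distrl /= factS -sum_v big_distrl /=.
apply: eq_bigr => i _.
case v_i: (v i) => [|k].
  rewrite mul0n big_pred0 // => t; apply/negbTE/forallPn; exists i.
  by rewrite /= eqxx v_i.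
pose v' j := (v j - (i == j))%N.
have v'i : v' i = k by rewrite /v' eqxx v_i subn1.
have v'D j : j != i -> v' j = v j.
  by rewrite /v' eq_sym => /negbTE->; apply: subn0.
have sum_v' : (\sum_j v' j)%N = n.
  apply/eqP; rewrite -eqSS -sum_v (bigD1 i) //= [X in _ == X](bigD1 i) //=.
  by rewrite v'i v_i -addSn (eq_bigr v).
have prod_v : (\prod_j (v j)`! = k.+1 * \prod_j (v' j)`!)%N.
  rewrite (bigD1 i) //= [in RHS](bigD1 i) //= mulnA v'i v_i -factS.
  by congr (_ * _)%N; apply: eq_bigr => j /v'D->.
rewrite prod_v mulnCA -(IHn v' sum_v') -sum1_card; congr (_ * (_ * _))%N.
apply: eq_bigl => t; rewrite inE; apply: eq_forallb => j /=.
have [<-|ij] := eqVneq i j; last by rewrite v'D // eq_sym.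
by rewrite v'i v_i add1n eqSS.
Qed.

Lemma card_ffun_fibres (T : finType) (n : nat) (v : T -> nat) :
  (\sum_i v i)%N = n ->
  (#|[set t : {ffun 'I_n -> T} | [forall i, #|[set u | t u == i]| == v i]]|
     * \prod_i (v i)`! = n`!)%N.
Proof.
move=> sum_v; rewrite -(card_tuple_count sum_v); congr (_ * _)%N.
rewrite -!sum1_card [RHS](reindex (@tuple_of_finfun T n)) /=; last first.
  by exists (@finfun_of_tuple T n) => t _;
    rewrite (tuple_of_finfunK, finfun_of_tupleK).
apply: eq_bigl => t; rewrite !inE; apply: eq_forallb => i; congr (_ == _).
by rewrite cardsE cardE -size_filter /= filter_map size_map enumT.
Qed.

Lemma sum_comp (K : pzSemiRingType) (S T : finType) (t : S -> T) (F : T -> K) :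
  \sum_u F (t u) = \sum_i #|[set u | t u == i]|%:R * F i.
Proof.
rewrite (partition_big t predT) //=; apply: eq_bigr => i _.
rewrite (eq_bigr (fun=> F i)) => [|u /eqP-> //].
by rewrite sumr_const mulr_natl cardsE.
Qed.

Lemma prod_comp (K : comPzSemiRingType) (S T : finType) (t : S -> T) (F : T -> K) :
  \prod_u F (t u) = \prod_i F i ^+ #|[set u | t u == i]|.
Proof.
rewrite (partition_big t predT) //=; apply: eq_bigr => i _.
rewrite (eq_bigr (fun=> F i)) => [|u /eqP-> //].
by rewrite prodr_const cardsE.
Qed.

(** * Multigraphs as edge multisets of sequences of pairs *)

Definition edge_match (n : nat) (e : upair n) (p : 'I_n * 'I_n) : bool :=
  [set p.1; p.2] == [set (val e).1; (val e).2].

Definition sort_pair (n : nat) (p : 'I_n * 'I_n) : 'I_n * 'I_n :=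
  if (p.1 <= p.2)%N then p else (p.2, p.1).

Lemma sort_pair_le (n : nat) (p : 'I_n * 'I_n) :
  ((sort_pair p).1 <= (sort_pair p).2)%N.
Proof. by rewrite /sort_pair; case: (leqP p.1) => //= /ltnW. Qed.

Definition upair_of (n : nat) (p : 'I_n * 'I_n) : upair n :=
  exist _ (sort_pair p) (sort_pair_le p).

(** A pair of vertices underlies a unique edge: a two-element set has only one
    increasing enumeration. *)
Lemma edge_matchE (n : nat) (e : upair n) (p : 'I_n * 'I_n) :
  edge_match e p = (e == upair_of p).
Proof.
apply/eqP/eqP => [|->] /=; last first.
  by rewrite /sort_pair; case: (leqP p.1) => //= _; rewrite setUC.
case: e p => -[a b] /= le_ab [u w] /setP eq_uw; apply: val_inj => /=.
rewrite /sort_pair /=.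
move: (eq_uw u) (eq_uw w) (eq_uw a) (eq_uw b); rewrite !inE !eqxx !orbT /=.
case/esym/orP=> /eqP ?; case/esym/orP=> /eqP ?; subst; rewrite ?eqxx ?orbT //=.
- by move=> _; rewrite orbb leqnn => /eqP->.
- by rewrite le_ab.
- case: leqP => // le_ba _ _.
  by have -> : a = b by apply/val_inj/eqP; rewrite eqn_leq le_ab.
- by rewrite orbb leqnn => /eqP->.
Qed.

Lemma sum_edge_count (n : nat) (s : seq ('I_n * 'I_n)) :
  (\sum_(e : upair n) count (edge_match e) s)%N = size s.
Proof.
under eq_bigr => e _ do rewrite -sum1_count.
rewrite (exchange_big_dep predT) //= -sum1_size; apply: eq_bigr => p _.
by under eq_bigl => e do rewrite edge_matchE; rewrite big_pred1_eq.
Qed.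

Section GraphOfSequence.
Variables (n m : nat) (s : m.-tuple ('I_n * 'I_n)).

Definition edge_mult : {ffun upair n -> 'I_m.+1} :=
  [ffun e => inord (count (edge_match e) s)].

Lemma edge_multE e : edge_mult e = count (edge_match e) s :> nat.
Proof.
by rewrite ffunE inordK // ltnS -[X in (_ <= X)%N](size_tuple s) count_size.
Qed.

Lemma edge_mult_sum : (\sum_(e : upair n) edge_mult e)%N == m.
Proof.
under eq_bigr => e _ do rewrite edge_multE.
by rewrite sum_edge_count size_tuple.
Qed.

Definition graph_of_seq : mgraph n m := MGraph edge_mult_sum.

(** The left-hand side is the condition under which s contributes to seqv(G). *)
Lemma seqv_graph_of_seq (G : mgraph n m) :
  [forall e : upair n, count (edge_match e) s == mult G e :> nat]
  = (G == graph_of_seq).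
Proof.
apply/forallP/eqP => [eqG | -> e]; last by rewrite /= edge_multE.
apply/val_inj/ffunP=> e; apply/val_inj.
by rewrite /= edge_multE; apply/esym/eqP.
Qed.

Lemma prod_graph_of_seq (K : comPzSemiRingType) (f : 'I_n -> 'I_n -> K) :
  (forall u w, f u w = f w u) ->
  \prod_(e : upair n) f (val e).1 (val e).2 ^+ mult graph_of_seq e
  = \prod_(p <- s) f p.1 p.2.
Proof.
move=> f_sym; pose F (e : upair n) := f (val e).1 (val e).2.
transitivity (\prod_(e : upair n) \prod_(p <- s | edge_match e p) F e).
  by apply: eq_bigr => e _; rewrite /= edge_multE big_const_seq -Monoid.iteropE.
rewrite (exchange_big_dep predT) //=; apply: eq_bigr => p _.
under eq_bigl => e do rewrite edge_matchE.
by rewrite big_pred1_eq /F /= /sort_pair; case: leqP => //= _; apply: f_sym.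
Qed.

End GraphOfSequence.

Lemma sum_tuple_prod (K : comPzSemiRingType) (T : finType) (m : nat) (F : T -> K) :
  \sum_(s : m.-tuple T) \prod_(x <- s) F x = (\sum_x F x) ^+ m.
Proof.
rewrite -[in RHS](card_ord m) -prodr_const bigA_distr_bigA /=.
rewrite (reindex (@tuple_of_finfun T m)) /=; last first.
  by exists (@finfun_of_tuple T m) => t _;
    rewrite (tuple_of_finfunK, finfun_of_tupleK).
by apply: eq_bigr => f _; rewrite big_map big_enum.
Qed.

Lemma sum_seqv_prod (K : comPzSemiRingType) (n m : nat) (f : 'I_n -> 'I_n -> K) :
  (forall u w, f u w = f w u) ->
  \sum_(G : mgraph n m)
     (seqv G)%:R * \prod_(e : upair n) f (val e).1 (val e).2 ^+ mult G e
  = (\sum_u \sum_w f u w) ^+ m.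
Proof.
move=> f_sym; pose W (G : mgraph n m) :=
  \prod_(e : upair n) f (val e).1 (val e).2 ^+ mult G e.
transitivity (\sum_(G : mgraph n m)
    \sum_(s : m.-tuple ('I_n * 'I_n) | G == graph_of_seq s) W G).
  apply: eq_bigr => G _; rewrite sumr_const mulr_natl; congr (_ *+ _).
  by apply: eq_card => s; rewrite inE seqv_graph_of_seq.
rewrite (exchange_big_dep predT) //= pair_big /= -sum_tuple_prod.
by apply: eq_bigr => s _; rewrite big_pred1_eq /W prod_graph_of_seq.
Qed.

(** * The weighted count *)

Theorem theorem2 (K : realType) (q : nat) (q_ge1 : (1 <= q)%N)
    (R : 'M[K]_q) (r : 'cV[K]_q)
    (R_sym : R^T = R) (R_irr : irreducible_mx R)
    (R_ge0 : forall i j : 'I_q, 0 <= R i j) (r_ge0 : forall i : 'I_q, 0 <= r i 0)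
    (n m : nat) (n_ge1 : (1 <= n)%N) :
  weighted_number R r [set: tgraph q n m]
  = (2 ^+ m * m`!%:R)^-1
    * \sum_(v : {ffun 'I_q -> 'I_n.+1} | (\sum_(i < q) v i)%N == n)
        multinomial K v * vpow r v
        * (((natcol K v)^T *m R *m natcol K v) 0 0) ^+ m.
Proof.
pose c : K := (2 ^+ m * m`!%:R)^-1.
pose fib (t : {ffun 'I_n -> 'I_q}) (i : 'I_q) := #|[set u | t u == i]|.
have fib_lt t i : (fib t i < n.+1)%N by rewrite ltnS -[leqRHS]card_ord max_card.
pose N t : {ffun 'I_q -> 'I_n.+1} := [ffun i => Ordinal (fib_lt t i)].
have NE t i : N t i = fib t i :> nat by rewrite ffunE.
have sum_N t : (\sum_i N t i)%N = n.
  transitivity (\sum_(u < n) 1)%N; last by rewrite sum1_card card_ord.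
  rewrite (partition_big t predT) //=; apply: eq_bigr => i _.
  by rewrite NE /fib -sum1dep_card.
pose Q (v : {ffun 'I_q -> 'I_n.+1}) : K := ((natcol K v)^T *m R *m natcol K v) 0 0.
have quad (t : {ffun 'I_n -> 'I_q}) : \sum_u \sum_w R (t u) (t w) = Q (N t).
  under eq_bigr => u _ do rewrite (sum_comp t (R (t u))).
  rewrite exchange_big /= /Q mxE; apply: eq_bigr => j _.
  rewrite -mulr_sumr (sum_comp t (R^~ j)) !mxE NE mulrC; congr (_ * _).
  by apply: eq_bigr => i _; rewrite !mxE NE.
rewrite /weighted_number.
transitivity (\sum_(t : {ffun 'I_n -> 'I_q}) c * (vpow r (N t) * Q (N t) ^+ m)).
  rewrite (eq_bigl predT) => [|G]; last by rewrite inE.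
  rewrite -(pair_big predT predT (fun g t => weight R r (g, t))) /= exchange_big.
  apply: eq_bigr => t _; rewrite -quad -sum_seqv_prod; last first.
    by move=> u w; rewrite -[in LHS]R_sym mxE.
  rewrite !mulr_sumr; apply: eq_bigr => g _.
  rewrite /weight /kappa /= (prod_comp t (r^~ 0)) -/c.
  have -> : vpow r (N t) = \prod_i r i 0 ^+ fib t i.
    by apply: eq_bigr => i _; rewrite NE.
  by rewrite [_%:R * c]mulrC -!mulrA; congr (_ * _); rewrite mulrCA.
rewrite -mulr_sumr; congr (_ * _).
rewrite (partition_big N (fun v => (\sum_(i < q) v i)%N == n)) /=; last first.
  by move=> t _; rewrite sum_N.
apply: eq_bigr => v /eqP sum_v.
rewrite (eq_bigr (fun=> vpow r v * Q v ^+ m)) => [|t /eqP-> //].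
rewrite sumr_const -mulrA -mulr_natl; congr (_ * _).
rewrite /multinomial -(card_ffun_fibres sum_v) natrM natr_prod mulfK.
  congr _%:R; apply: eq_card => t; transitivity (N t == v) => //; rewrite inE.
  apply/eqP/forallP => [<- i | eqv]; first by rewrite NE.
  by apply/ffunP=> i; apply/val_inj; rewrite /= NE; apply/eqP/eqv.
by apply/prodf_neq0 => i _; rewrite pnatr_eq0 -lt0n fact_gt0.
Qed.
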